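(* Let $G$ be a Gauss diagram. For any $\gamma\in H_1(G)$ one has the decomposition $$\gamma=\sum_{A}\langle\gamma,A\rangle\,[A]+E(\gamma)\,[K],$$ where the sum runs over all arrows $A$ of $G$.
   Context: A Gauss diagram $G$ of degree $n$ is an oriented circle with $2n$ distinct points paired by $n$ abstract oriented arrows (each from a tail to a head; signs and other decorations are irrelevant here). Its edges are the $2n$ arcs of circle between consecutive arrow ends (the whole circle if $n=0$). $G$ is regarded as a $1$-dimensional cell complex whose oriented $1$-cells are the edges and the arrows (arrows do not intersect topologically); $H_1(G)$ is its first integral homology group. For a $1$-cell $c$, $\langle\cdot,c\rangle:H_1(G)\to\mathbb Z$ is the coordinate along $c$ (well defined since there are no $2$-cells). For an arrow $A$, $[A]\in H_1(G)$ is the class of its fundamental loop: the loop that goes along $A$ from tail to head and then along the circle, following its orientation, from the head of $A$ to the tail of $A$. $[K]$ is the class of the base circle. The energy is the homomorphism $E:H_1(G)\to\mathbb Z$ defined, for any choice of an edge $e$ (it does not depend on the choice), by $$E(\gamma)=\langle\gamma,e\rangle-\sum_{A:\ \langle[A],e\rangle=1}\langle\gamma,A\rangle .$$ *)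

(* Defs.v *)
From HB Require Import structures.
From mathcomp Require Import all_boot all_order all_algebra.

Set Implicit Arguments.
Unset Strict Implicit.
Unset Printing Implicit Defensive.

Import GRing.Theory.
Local Open Scope ring_scope.

(* The 2n marked points are numbered 0, ..., 2n - 1 in the order in which they
   are met along the oriented circle, starting anywhere. [ends (inl A)] is the
   tail of the arrow A and [ends (inr A)] is its head; bijectivity says that
   the arrows pair up the 2n points. *)
Record gaussDiagram := GaussDiagram {
  degree : nat;
  ends : 'I_degree + 'I_degree -> 'I_(degree.*2);
  ends_bij : bijective ends
}.

Definition arrow (G : gaussDiagram) := 'I_(degree G).

(* The 0-cells are the marked points. When there is none, the circle gets one
   base point, so that its only edge (the whole circle) is a 1-cell. *)
Definition vertex (G : gaussDiagram) := 'I_(maxn 1 (degree G).*2).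

(* The edge e is the arc that starts at the vertex e and ends at the next
   vertex, [ordS e], which is e itself when the circle has only one vertex. *)
Definition edge (G : gaussDiagram) := 'I_(maxn 1 (degree G).*2).

Section Homology.
Variable G : gaussDiagram.

Definition point_vertex (p : 'I_((degree G).*2)) : vertex G :=
  widen_ord (leq_maxr 1 (degree G).*2) p.

Definition arrow_tail (A : arrow G) : vertex G := point_vertex (ends (inl A)).
Definition arrow_head (A : arrow G) : vertex G := point_vertex (ends (inr A)).

Definition cell : Type := (edge G + arrow G)%type.

Definition edge_cell (e : edge G) : cell := inl e.
Definition arrow_cell (A : arrow G) : cell := inr A.

Definition source (c : cell) : vertex G :=
  match c with inl e => e | inr A => arrow_tail A end.
Definition target (c : cell) : vertex G :=
  match c with inl e => ordS e | inr A => arrow_head A end.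

Local Notation chain1 := {ffun cell -> int}.
Local Notation chain0 := {ffun vertex G -> int}.

Definition boundary (x : chain1) : chain0 :=
  [ffun v => \sum_(c : cell) x c * ((v == target c)%:R - (v == source c)%:R)].

Lemma boundary_is_zmod_morphism : zmod_morphism boundary.
Proof.
move=> x y; apply/ffunP => v; rewrite !ffunE -sumrB.
by apply: eq_bigr => c _; rewrite !ffunE mulrBl.
Qed.

HB.instance Definition _ :=
  GRing.isZmodMorphism.Build chain1 chain0 boundary boundary_is_zmod_morphism.

Definition cycle1 : {pred chain1} := [pred x | boundary x == 0].

Lemma cycle1_zmod_closed : zmod_closed cycle1.
Proof.
split; first by apply/eqP/raddf0.
move=> x y; rewrite !unfold_in => /eqP x0 /eqP y0.
by apply/eqP; rewrite raddfB /= x0 y0 subr0.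
Qed.

HB.instance Definition _ :=
  GRing.isZmodClosed.Build chain1 cycle1 cycle1_zmod_closed.

(* There are no 2-cells, so H_1 is the group of 1-cycles itself. *)
Definition H1 : Type := {x : chain1 | x \in cycle1}.
HB.instance Definition _ := SubChoice.on H1.
HB.instance Definition _ := [SubChoice_isSubZmodule of H1 by <:].

Definition cell_coord (g : H1) (c : cell) : int := val g c.

Lemma cell_coordB g h c : cell_coord (g - h) c = cell_coord g c - cell_coord h c.
Proof. by rewrite /cell_coord raddfB !ffunE. Qed.

(* [arc (enum (vertex G)) p q] lists the vertices met along the oriented circle
   from p (included) up to q (excluded), that is, the edges of the arc from p
   to q, each edge being named after its first vertex. *)
Definition on_arc (p q : vertex G) (e : edge G) : bool :=
  e \in arc (enum 'I_(maxn 1 (degree G).*2)) p q.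

Definition loop_chain (A : arrow G) : chain1 :=
  [ffun c : cell => match c return int with
                    | inl e => (on_arc (arrow_head A) (arrow_tail A) e)%:R
                    | inr B => (B == A)%:R
                    end].

Definition circle_chain : chain1 :=
  [ffun c : cell => match c return int with inl _ => 1 | inr _ => 0 end].

Lemma head_neq_tail A : arrow_head A != arrow_tail A.
Proof.
apply/eqP => /(congr1 val) /= eqHT.
by have /(bij_inj (ends_bij G)) : ends (inr A) = ends (inl A) by apply: val_inj.
Qed.

Lemma enum_fcycle n : fcycle (@ordS n) (enum 'I_n).
Proof.
have sz : size (enum 'I_n) = n := size_enum_ord n.
case Es: (enum 'I_n) => [//|x t]; rewrite Es in sz.
apply/(pathP x) => i; rewrite size_rcons => lt_i; apply/eqP/val_inj.
have i_n : (i < n)%N by rewrite -sz.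
have nthS j : (j < n)%N -> val (nth x (x :: t) j) = j.
  by move=> lt_j; rewrite -Es; apply: nth_enum_ord.
rewrite -rcons_cons nth_rcons [size _]/= lt_i [LHS]/= nthS //.
rewrite nth_rcons if_same; have [lt_it|le_ti] := ltnP i (size t).
  have lt_i1 : (i.+1 < n)%N by rewrite -sz.
  by rewrite -[nth x t i]/(nth x (x :: t) i.+1) nthS ?modn_small.
have -> : i.+1 = n by apply/eqP; rewrite eqn_leq i_n -sz.
by rewrite modnn; apply/esym/(nthS 0); rewrite -sz.
Qed.

Lemma path_sum (p q v : vertex G) t : fpath (@ordS _) p (rcons t q) ->
  \sum_(e <- p :: t) ((v == ordS e)%:R - (v == e)%:R)
  = (v == q)%:R - (v == p)%:R :> int.
Proof.
elim: t p => [|x t IHt] p /=; first by rewrite andbT big_seq1 => /eqP ->.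
by case/andP=> /eqP pE /IHt; rewrite big_cons pE => ->; rewrite addrC subrKA.
Qed.

Lemma boundary_arc (p q v : vertex G) : p != q ->
  \sum_(e : edge G) (on_arc p q e)%:R * ((v == ordS e)%:R - (v == e)%:R)
  = (v == q)%:R - (v == p)%:R :> int.
Proof.
move=> neq_pq; set s := enum 'I_(maxn 1 (degree G).*2).
have s_uniq : uniq s := enum_uniq _.
have [i p1 p2 arc_pq _ rot_s] :=
  rot_to_arc s_uniq (mem_enum _ p) (mem_enum _ q) neq_pq.
have := s_uniq; rewrite -(rot_uniq i) rot_s -cat_cons cat_uniq => /andP[p1_uniq _].
have := enum_fcycle (maxn 1 (degree G).*2).
rewrite -(rot_cycle i) -/s rot_s /= rcons_cat cat_path /= => /and3P[p1_path p1q _].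
rewrite -(@path_sum p q v p1); last by rewrite rcons_path p1_path.
rewrite [RHS]big_uniq // [RHS]big_mkcond /=.
apply: eq_bigr => e _; rewrite /on_arc -/s -arc_pq.
by case: (e \in _); rewrite (mul1r, mul0r).
Qed.

Lemma loop_chain_cycle A : loop_chain A \in cycle1.
Proof.
apply/eqP/ffunP => v; rewrite !ffunE big_sumType /=.
under eq_bigr do rewrite ffunE.
rewrite boundary_arc ?head_neq_tail // (bigD1 A) //= big1 => [|B neqBA].
  by rewrite ffunE eqxx mul1r addr0 addrC subrKA subrr.
by rewrite ffunE (negPf neqBA) mul0r.
Qed.

Lemma circle_chain_cycle : circle_chain \in cycle1.
Proof.
apply/eqP/ffunP => v; rewrite !ffunE big_sumType /= [X in _ + X]big1.
  rewrite addr0; under eq_bigr do rewrite ffunE mul1r.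
  rewrite sumrB; apply/eqP; rewrite subr_eq0; apply/eqP.
  have [f' fK f'K] := ordS_bij (maxn 1 (degree G).*2).
  rewrite [RHS](reindex (@ordS _)) //=.
  by exists f' => x _.
by move=> B _; rewrite ffunE mul0r.
Qed.

Definition arrow_class (A : arrow G) : H1 :=
  exist _ (loop_chain A) (loop_chain_cycle A).
Definition circle_class : H1 := exist _ circle_chain circle_chain_cycle.

Definition energy (e : edge G) (g : H1) : int :=
  cell_coord g (edge_cell e)
  - \sum_(A : arrow G | cell_coord (arrow_class A) (edge_cell e) == 1)
      cell_coord g (arrow_cell A).

Lemma energy_is_zmod_morphism e : zmod_morphism (energy e).
Proof.
move=> g h; rewrite /energy cell_coordB; under eq_bigr do rewrite cell_coordB.
by rewrite sumrB opprD addrACA -opprD.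
Qed.

HB.instance Definition _ e :=
  GRing.isZmodMorphism.Build H1 int (energy e) (energy_is_zmod_morphism e).

End Homology.

(* Main.v *)
(* Subtracting sum_A <gamma, A> [A] from gamma leaves a cycle with no coordinate
   along the arrows. The boundary condition at each vertex forces such a cycle
   to have the same coordinate along all edges, hence to be a multiple of [K];
   reading that multiple on the edge e gives the energy. *)
Require Import Defs.
From HB Require Import structures.
From mathcomp Require Import all_boot all_order all_algebra.
Import GRing.Theory.
Local Open Scope ring_scope.

(** The cell comes first so that, for a fixed cell, this is a homomorphism on [H1 G] to which the
    [raddf] lemmas apply. *)
Definition coord_along {G : gaussDiagram} (c : cell G) (g : H1 G) : int :=
  cell_coord g c.

HB.instance Definition _ (G : gaussDiagram) (c : cell G) :=
  GRing.isZmodMorphism.Build (H1 G) int (coord_along c)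
    (fun g h => cell_coordB g h c).

Lemma H1_eqP (G : gaussDiagram) (g h : H1 G) :
  (forall c, coord_along c g = coord_along c h) -> g = h.
Proof. by move=> eq_gh; apply/val_inj/ffunP. Qed.

Lemma ordS_invariant_const (T : Type) (n : nat) (f : 'I_n -> T) :
  (forall i, f (ordS i) = f i) -> forall i j, f i = f j.
Proof.
move=> fS i j; have n_gt0 : (0 < n)%N := leq_ltn_trans (leq0n i) (ltn_ord i).
suff f0 k (lt_kn : (k < n)%N) : f (Ordinal lt_kn) = f (Ordinal n_gt0).
  by case: i j => [i lt_in] [j lt_jn]; rewrite !f0.
elim: k lt_kn => [|k IHk] lt_kn; first by congr f; apply: val_inj.
rewrite -(IHk (ltnW lt_kn)) -[RHS]fS; congr f; apply: val_inj.
by rewrite /= modn_small.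
Qed.

(** Without arrows, only the edge [v] enters the vertex [ordS v] and only the edge [ordS v] leaves
    it, so the boundary there is the difference of their coordinates. In degree 0 the two edges
    coincide. *)
Lemma cycle_edge_coordS (G : gaussDiagram) (g : H1 G) :
  (forall A, coord_along (arrow_cell A) g = 0) ->
  forall v : edge G,
    coord_along (edge_cell (ordS v)) g = coord_along (edge_cell v) g.
Proof.
move=> gA0 v; have /eqP/ffunP/(_ (ordS v)) := valP g.
rewrite !ffunE big_sumType /= [X in _ + X]big1 => [|A _]; last first.
  by rewrite [val g _]gA0 mul0r.
have ordS_inj := bij_inj (ordS_bij (maxn 1 (degree G).*2)).
under eq_bigr do rewrite mulrBr (inj_eq ordS_inj) ![v == _]eq_sym
  ![ordS v == _]eq_sym !mulr_natr !mulrb.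
by rewrite addr0 sumrB -!big_mkcond /= !big_pred1_eq => /subr0_eq.
Qed.

Lemma arrow_free_cycle (G : gaussDiagram) (g : H1 G) (e : edge G) :
  (forall A, coord_along (arrow_cell A) g = 0) ->
  g = circle_class G *~ coord_along (edge_cell e) g.
Proof.
move=> gA0; apply: H1_eqP => -[e'|A]; rewrite raddfMz /=.
  rewrite [coord_along _ (circle_class G)]ffunE intz.
  exact: (ordS_invariant_const _ _ _ (cycle_edge_coordS _ _ gA0)).
by rewrite [coord_along _ (circle_class G)]ffunE mul0rz; apply: gA0.
Qed.

(** A fundamental loop has coordinate 0 or 1 along [e], so the condition selecting the arrows in
    [energy] amounts to weighting by that coordinate. *)
Lemma energyE (G : gaussDiagram) (gamma : H1 G) (e : edge G) :
  energy e gamma = coord_along (edge_cell e)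
    (gamma - \sum_(A : arrow G) arrow_class A *~ cell_coord gamma (arrow_cell A)).
Proof.
rewrite raddfB raddf_sum /energy big_mkcond; congr (_ - _).
apply: eq_bigr => A _; rewrite raddfMz /= /coord_along.
rewrite [cell_coord (arrow_class A) _]ffunE /edge_cell.
by case: (on_arc (arrow_head A) (arrow_tail A) e); rewrite ?mul0rz ?intz.
Qed.

Theorem theorem3p15 (G : gaussDiagram) (gamma : H1 G) (e : edge G) :
  gamma = \sum_(A : arrow G) arrow_class A *~ cell_coord gamma (arrow_cell A)
          + circle_class G *~ energy e gamma.
Proof.
rewrite energyE -arrow_free_cycle => [|A]; first by rewrite addrC subrK.
(* The loop of [B] runs along no arrow but [B], so only the term of [A] survives and it cancels the
   coordinate of [gamma]. *)
rewrite raddfB raddf_sum (bigD1 A) //= big1 => [|B neqBA].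
  rewrite raddfMz /= [coord_along _ (arrow_class A)]ffunE /arrow_cell eqxx intz addr0.
  exact: subrr.
rewrite raddfMz /= [coord_along _ (arrow_class B)]ffunE /arrow_cell eq_sym (negPf neqBA).
exact: mul0rz.
Qed.
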